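(* Let $n\ge 2$, let $m_1,\dots,m_n>0$ and $\gamma>0$ be constants. Consider the autonomous system of first-order ordinary differential equations in the unknowns $\vec r_i=(x_i,y_i,z_i)\in\mathbb{R}^3$, $\vec v_i=(u_i,v_i,w_i)\in\mathbb{R}^3$ ($1\le i\le n$), $r_{ij}=r_{ji}\in\mathbb{R}\setminus\{0\}$ and $\rho_{ij}=\rho_{ji}\in\mathbb{R}$ ($i\neq j$), all regarded as independent variables: $$\dot{\vec r}_i=\vec v_i,\qquad i=1,\dots,n,$$ $$m_i\dot{\vec v}_i=\sum_{j\ne i}\gamma\,\frac{m_im_j\rho_{ij}}{r_{ij}^2}\,(\vec r_j-\vec r_i),\qquad i=1,\dots,n,$$ $$\dot r_{ij}=\frac{1}{r_{ij}}(\vec r_i-\vec r_j)\cdot(\vec v_i-\vec v_j),\qquad i,j=1,\dots,n,\ i\ne j,$$ $$\dot\rho_{ij}=-\frac{\rho_{ij}}{r_{ij}^2}(\vec r_i-\vec r_j)\cdot(\vec v_i-\vec v_j),\qquad i,j=1,\dots,n,\ i\ne j.$$ Then the following quantities are integrals of motion of this system: 1. the momentum $\sum_{i=1}^n m_i\vec v_i$ (3 scalar integrals); 2. the angular momentum $\sum_{i=1}^n m_i\,\vec v_i\times\vec r_i$ (3 scalar integrals); 3. the center-of-mass integral $\sum_{i=1}^n m_i\vec r_i-t\sum_{i=1}^n m_i\vec v_i$ (3 scalar integrals); 4. the energy in the form $\sum_{i=1}^n\frac{m_i}{2}(u_i^2+v_i^2+w_i^2)-\gamma\sum_{1\le i<j\le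 n}m_im_j\rho_{ij}$; 5. for every $i\neq j$, the quantity $r_{ij}^2-(x_i-x_j)^2-(y_i-y_j)^2-(z_i-z_j)^2$; 6. for every $i\neq j$, the quantity $r_{ij}\rho_{ij}$.
   Context: An integral of motion of a system of ordinary differential equations is a function of the unknowns (and possibly of the time $t$) that is constant along every solution of the system. A dot denotes the derivative with respect to $t$; $\cdot$ and $\times$ denote the scalar and vector products in $\mathbb{R}^3$. The variables $r_{ij}$ and $\rho_{ij}$ are independent unknowns of the system and are not assumed to equal the distances $|\vec r_i-\vec r_j|$ and their reciprocals; there is one variable $r_{ij}$ and one variable $\rho_{ij}$ for each unordered pair, so $r_{ij}=r_{ji}$ and $\rho_{ij}=\rho_{ji}$. The letter $v_i$ without an arrow denotes the second component of the vector $\vec v_i$. *)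

(* Defs.v *)
From HB Require Import structures.
From mathcomp Require Import all_boot all_order all_algebra.
From mathcomp Require Import all_classical all_reals all_analysis.

Set Implicit Arguments.
Unset Strict Implicit.
Unset Printing Implicit Defensive.

Import Order.TTheory GRing.Theory Num.Theory.
Import numFieldNormedType.Exports.

Local Open Scope classical_set_scope.
Local Open Scope ring_scope.

Definition dotv (R : realType) (a b : 'rV[R]_3) : R :=
  \sum_(k < 3) a 0 k * b 0 k.

(* The indices k + 1 and k + 2 are computed modulo 3 in 'I_3. *)
Definition crossv (R : realType) (a b : 'rV[R]_3) : 'rV[R]_3 :=
  \row_(k < 3) (a 0 (k + 1) * b 0 (k + 2) - a 0 (k + 2) * b 0 (k + 1)).

(* A point of the phase space. [dist] and [rho] are independent unknowns, not
   functions of [pos]. The symmetry fields make them depend on the unordered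
   pair {i, j} only; their diagonal values are irrelevant and are never
   used. *)
Record state (R : realType) (n : nat) := State {
  pos : 'I_n -> 'rV[R]_3;
  vel : 'I_n -> 'rV[R]_3;
  dist : 'I_n -> 'I_n -> R;
  rho : 'I_n -> 'I_n -> R;
  distC : forall i j, dist i j = dist j i;
  rhoC : forall i j, rho i j = rho j i;
  dist_neq0 : forall i j, i != j -> dist i j != 0
}.

(* Only the restriction of the trajectory [s] to [J] matters when [J] is
   open. *)
Record solution (R : realType) (n : nat) (m : 'I_n -> R) (gamma : R)
    (J : set R) (s : R -> state R n) : Prop := Solution {
  sol_pos : forall t, J t -> forall i,
    is_derive t 1 (fun x : R => pos (s x) i) (vel (s t) i);
  sol_vel_derivable : forall t, J t -> forall i,
    derivable (fun x : R => vel (s x) i) t 1;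
  sol_vel : forall t, J t -> forall i,
    m i *: 'D_1 (fun x : R => vel (s x) i) t =
    \sum_(j < n | j != i)
      (gamma * (m i * m j * rho (s t) i j / dist (s t) i j ^+ 2))
        *: (pos (s t) j - pos (s t) i);
  sol_dist : forall t, J t -> forall i j, i != j ->
    is_derive t 1 (fun x : R => dist (s x) i j)
      ((dist (s t) i j)^-1
       * dotv (pos (s t) i - pos (s t) j) (vel (s t) i - vel (s t) j));
  sol_rho : forall t, J t -> forall i j, i != j ->
    is_derive t 1 (fun x : R => rho (s x) i j)
      (- (rho (s t) i j / dist (s t) i j ^+ 2)
       * dotv (pos (s t) i - pos (s t) j) (vel (s t) i - vel (s t) j))
}.

(* The first argument of [F] is the time. The codomain [T] is arbitrary, so
   that a vector integral stands for its scalar components. *)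
Definition integral_of_motion (R : realType) (n : nat) (m : 'I_n -> R)
    (gamma : R) (T : Type) (F : R -> state R n -> T) : Prop :=
  forall (J : set R) (s : R -> state R n),
    open J -> is_interval J -> solution m gamma J s ->
    forall t1 t2, J t1 -> J t2 -> F t1 (s t1) = F t2 (s t2).

Definition momentum (R : realType) (n : nat) (m : 'I_n -> R)
    (p : state R n) : 'rV[R]_3 :=
  \sum_(i < n) m i *: vel p i.

Definition angular_momentum (R : realType) (n : nat) (m : 'I_n -> R)
    (p : state R n) : 'rV[R]_3 :=
  \sum_(i < n) m i *: crossv (vel p i) (pos p i).

Definition center_of_mass (R : realType) (n : nat) (m : 'I_n -> R)
    (t : R) (p : state R n) : 'rV[R]_3 :=
  (\sum_(i < n) m i *: pos p i) - t *: (\sum_(i < n) m i *: vel p i).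

Definition energy (R : realType) (n : nat) (m : 'I_n -> R) (gamma : R)
    (p : state R n) : R :=
  (\sum_(i < n)
     m i / 2 * (vel p i 0 0 ^+ 2 + vel p i 0 1 ^+ 2 + vel p i 0 2 ^+ 2))
  - gamma * (\sum_(i < n) \sum_(j < n | (i < j)%N) m i * m j * rho p i j).

Definition distance_defect (R : realType) (n : nat) (i j : 'I_n)
    (p : state R n) : R :=
  dist p i j ^+ 2 - (pos p i 0 0 - pos p j 0 0) ^+ 2
  - (pos p i 0 1 - pos p j 0 1) ^+ 2 - (pos p i 0 2 - pos p j 0 2) ^+ 2.

(* Main.v *)
Require Import Defs.
From HB Require Import structures.
From mathcomp Require Import all_boot all_order all_algebra.
From mathcomp Require Import all_classical all_reals all_analysis.
From mathcomp Require Import ring.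

Set Implicit Arguments.
Unset Strict Implicit.
Unset Printing Implicit Defensive.

Import Order.TTheory GRing.Theory Num.Theory.
Import numFieldNormedType.Exports.

Local Open Scope classical_set_scope.
Local Open Scope ring_scope.

(** Each quantity has zero derivative along every solution, and a function with
    zero derivative on an interval is constant there by the mean value theorem
    ([constant_on_interval]).

    The force that body [j] exerts on body [i] is antisymmetric in [i] and [j]
    ([pair_forceC]) and parallel to [pos j - pos i]. A double sum over ordered
    pairs is a sum over the pairs [i < j] of the two contributions
    ([sum_offdiag]), so:
    - the two forces of a pair cancel, which makes the total force vanish and
      conserves the momentum; the center of mass then moves uniformly;
    - the two torques of a pair add up to the cross product of the force with
      [pos i - pos j], which is parallel to it; the total torque vanishes
      ([sum_pair_torque]) and the angular momentum is conserved;
    - the two powers of a pair add up to the dot product of the force with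
      [vel i - vel j], and the equation for [rho] is exactly what makes this the
      derivative of [gamma * m i * m j * rho i j] ([sum_pair_power]); kinetic
      and potential energy thus balance, whatever relation holds between
      [dist], [rho] and the positions.

    The last two families involve a single pair: the equations for [dist] and
    [rho] say that [dist ^+ 2] has the derivative of the squared distance and
    that [rho] solves the linear equation that [dist^-1] solves. *)

(** * Differentiation of vector-valued functions *)

Lemma is_derive_coordP (R : realType) (p q : nat) (f : R -> 'M[R]_(p, q))
    (t : R) (df : 'M[R]_(p, q)) :
  is_derive t 1 f df <->
  forall i j, is_derive t 1 (fun x => f x i j) (df i j).
Proof.
split=> [[fD fE] i j|fD].
  apply: DeriveDef; first exact: (derivable_mxP _ _ _).1.
  by rewrite -fE derive_mx // mxE.
have fderiv : derivable f t 1.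
  by apply/derivable_mxP => i j; case: (fD i j).
apply: DeriveDef => //.
by rewrite derive_mx //; apply/matrixP => i j; rewrite mxE; case: (fD i j).
Qed.

(** Sums in the potential energy are restricted to [i < j], so the index
    predicate is needed here; the summands outside it are replaced by the zero
    function, which reduces the claim to unrestricted sums. *)
Lemma is_derive_sum_cond (R : numFieldType) (V W : normedModType R) (n : nat)
    (P : pred 'I_n) (f : 'I_n -> V -> W) (df : 'I_n -> W) (t v : V) :
  (forall i, P i -> is_derive t v (f i) (df i)) ->
  is_derive t v (fun x => \sum_(i < n | P i) f i x) (\sum_(i < n | P i) df i).
Proof.
move=> fD.
have -> : (fun x => \sum_(i < n | P i) f i x)
    = \sum_(i < n) (if P i then f i else cst 0).
  apply/funext => x; rewrite fct_sumE big_mkcond /=.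
  by apply: eq_bigr => i _; case: (P i).
rewrite [X in is_derive _ _ _ X]big_mkcond /=.
apply: is_derive_sum => i.
by case: (boolP (P i)) => [/fD|_] //; exact: is_derive_cst.
Qed.

Lemma is_derive_dotv (R : realType) (f g : R -> 'rV[R]_3) (t : R)
    (df dg : 'rV[R]_3) :
  is_derive t 1 f df -> is_derive t 1 g dg ->
  is_derive t 1 (fun x => dotv (f x) (g x)) (dotv (f t) dg + dotv df (g t)).
Proof.
move=> /is_derive_coordP fD /is_derive_coordP gD.
rewrite /dotv -big_split /=.
apply: is_derive_sum_cond => k _.
rewrite [df 0 k * _]mulrC.
exact: is_deriveM (fD 0 k) (gD 0 k).
Qed.

Lemma is_derive_crossv (R : realType) (f g : R -> 'rV[R]_3) (t : R)
    (df dg : 'rV[R]_3) :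
  is_derive t 1 f df -> is_derive t 1 g dg ->
  is_derive t 1 (fun x => crossv (f x) (g x))
    (crossv (f t) dg + crossv df (g t)).
Proof.
move=> /is_derive_coordP fD /is_derive_coordP gD.
apply/is_derive_coordP => i k; rewrite !mxE.
under eq_fun do rewrite !mxE.
have D := is_deriveB (is_deriveM (fD 0 (k + 1)) (gD 0 (k + 2)))
                     (is_deriveM (fD 0 (k + 2)) (gD 0 (k + 1))).
by apply: (is_derive_eq D); rewrite /GRing.scale /=; ring.
Qed.

Lemma is_derive_id_scale (R : realType) (f : R -> 'rV[R]_3) (t : R)
    (df : 'rV[R]_3) :
  is_derive t 1 f df -> is_derive t 1 (fun x => x *: f x) (f t + t *: df).
Proof.
move=> /is_derive_coordP fD; apply/is_derive_coordP => i k.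
under eq_fun do rewrite mxE.
have D := is_deriveM (is_derive_id t (1 : R)) (fD i k).
by apply: (is_derive_eq D); rewrite !mxE /GRing.scale /=; ring.
Qed.

(** * Functions with zero derivative on an interval *)

Lemma constant_on_interval (R : realType) (J : set R) (f : R -> R) (t1 t2 : R) :
  is_interval J -> (forall t, J t -> is_derive t 1 f 0) ->
  J t1 -> J t2 -> f t1 = f t2.
Proof.
move=> Jitv fD.
wlog t12 : t1 t2 / t1 <= t2.
  by move=> H J1 J2; case: (leP t1 t2) => [|/ltW] /H ->.
move=> J1 J2.
have sub x : x \in `[t1, t2] -> J x.
  by rewrite in_itv /= => /andP[t1x xt2]; apply: (Jitv t1 t2) => //; apply/andP.
have [x xJ|x xJ|_ _] := @MVT_segment R f (fun=> 0) t1 t2 t12.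
- by apply/fD/sub; apply: subset_itv_oo_cc.
- by apply: derivable_within_continuous => y /sub /fD [].
- by rewrite mul0r => /eqP; rewrite subr_eq0 => /eqP.
Qed.

Lemma mx_constant_on_interval (R : realType) (p q : nat) (J : set R)
    (f : R -> 'M[R]_(p, q)) (t1 t2 : R) :
  is_interval J -> (forall t, J t -> is_derive t 1 f 0) ->
  J t1 -> J t2 -> f t1 = f t2.
Proof.
move=> Jitv fD J1 J2; apply/matrixP => i j.
apply: (@constant_on_interval R J (fun x => f x i j)) => // t Jt.
by have /is_derive_coordP/(_ i j) := fD t Jt; rewrite mxE.
Qed.

(** * Algebra of the dot and cross products *)

Lemma dotvE (R : realType) (a b : 'rV[R]_3) :
  dotv a b = a 0 0 * b 0 0 + a 0 1 * b 0 1 + a 0 2 * b 0 2.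
Proof.
rewrite /dotv !big_ord_recr big_ord0 /= add0r.
by congr (_ + _ + _); congr (a _ _ * b _ _); apply/val_inj.
Qed.

Lemma dotvDl (R : realType) (a b c : 'rV[R]_3) :
  dotv (a + b) c = dotv a c + dotv b c.
Proof.
by rewrite /dotv -big_split; apply: eq_bigr => k _; rewrite mxE mulrDl.
Qed.

Lemma dotvC (R : realType) (a b : 'rV[R]_3) : dotv a b = dotv b a.
Proof. by apply: eq_bigr => k _; rewrite mulrC. Qed.

Lemma dotvZl (R : realType) (x : R) (a b : 'rV[R]_3) :
  dotv (x *: a) b = x * dotv a b.
Proof.
by rewrite /dotv mulr_sumr; apply: eq_bigr => k _; rewrite mxE mulrA.
Qed.

Lemma dotv_suml (R : realType) (n : nat) (P : pred 'I_n)
    (f : 'I_n -> 'rV[R]_3) (b : 'rV[R]_3) :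
  dotv (\sum_(j < n | P j) f j) b = \sum_(j < n | P j) dotv (f j) b.
Proof.
apply: (big_morph (fun a => dotv a b)) => [a c|]; first exact: dotvDl.
by rewrite -[0](scale0r 0) dotvZl mul0r.
Qed.

Lemma crossvDl (R : realType) (a b c : 'rV[R]_3) :
  crossv (a + b) c = crossv a c + crossv b c.
Proof. by apply/rowP => k; rewrite !mxE; ring. Qed.

Lemma crossvZl (R : realType) (x : R) (a b : 'rV[R]_3) :
  crossv (x *: a) b = x *: crossv a b.
Proof. by apply/rowP => k; rewrite !mxE; ring. Qed.

Lemma crossvv (R : realType) (a : 'rV[R]_3) : crossv a a = 0.
Proof. by apply/rowP => k; rewrite !mxE mulrC subrr. Qed.

Lemma crossv_suml (R : realType) (n : nat) (P : pred 'I_n)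
    (f : 'I_n -> 'rV[R]_3) (b : 'rV[R]_3) :
  crossv (\sum_(j < n | P j) f j) b = \sum_(j < n | P j) crossv (f j) b.
Proof.
apply: (big_morph (fun a => crossv a b)) => [a c|]; first exact: crossvDl.
by apply/rowP => k; rewrite !mxE; ring.
Qed.

(** * Interaction of pairs *)

(** Exchanging the two summations turns the terms below the diagonal into terms
    above it. This is how the two halves of an interaction meet. *)
Lemma sum_offdiag (V : nmodType) (n : nat) (F : 'I_n -> 'I_n -> V) :
  \sum_(i < n) \sum_(j < n | j != i) F i j =
  \sum_(i < n) \sum_(j < n | (i < j)%N) (F i j + F j i).
Proof.
under [RHS]eq_bigr do rewrite big_split /=.
rewrite big_split /= [X in _ = _ + X](exchange_big_dep predT) //= -big_split /=.
apply: eq_bigr => i _; rewrite (bigID (fun j : 'I_n => (i < j)%N)) /=.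
by congr (_ + _); apply: eq_bigl => j; rewrite -val_eqE /= neq_ltn -?leqNgt;
   case: ltngtP.
Qed.

Definition pair_force (R : realType) (n : nat) (m : 'I_n -> R) (gamma : R)
    (p : state R n) (i j : 'I_n) : 'rV[R]_3 :=
  (gamma * (m i * m j * rho p i j / dist p i j ^+ 2)) *: (pos p j - pos p i).

(** Newton's third law. It rests on the symmetry of [rho] and [dist]. *)
Lemma pair_forceC (R : realType) (n : nat) (m : 'I_n -> R) (gamma : R)
    (p : state R n) (i j : 'I_n) :
  pair_force m gamma p j i = - pair_force m gamma p i j.
Proof.
by rewrite /pair_force -scalerN opprB rhoC distC [m j * m i]mulrC.
Qed.

Lemma sum_pair_force (R : realType) (n : nat) (m : 'I_n -> R) (gamma : R)
    (p : state R n) :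
  \sum_(i < n) \sum_(j < n | j != i) pair_force m gamma p i j = 0.
Proof.
rewrite sum_offdiag big1 // => i _; rewrite big1 // => j _.
by rewrite [X in _ + X]pair_forceC subrr.
Qed.

(** The two torques of a pair combine to the cross product of the force with
    [pos i - pos j], and the force is central. *)
Lemma sum_pair_torque (R : realType) (n : nat) (m : 'I_n -> R) (gamma : R)
    (p : state R n) :
  \sum_(i < n) crossv (\sum_(j < n | j != i) pair_force m gamma p i j) (pos p i)
  = 0.
Proof.
under eq_bigr do rewrite crossv_suml.
rewrite (sum_offdiag (fun i j => crossv (pair_force m gamma p i j) (pos p i))).
rewrite big1 // => i _; rewrite big1 // => j _.
by apply/rowP => k; rewrite (pair_forceC _ _ _ i j) !mxE; ring.
Qed.

(** The right-hand side is the derivative of [gamma] times the sum of the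
    [m i * m j * rho i j], with the derivative of [rho] replaced by the value
    that the system prescribes: the forces work at the expense of the potential
    energy. *)
Lemma sum_pair_power (R : realType) (n : nat) (m : 'I_n -> R) (gamma : R)
    (p : state R n) :
  \sum_(i < n) dotv (\sum_(j < n | j != i) pair_force m gamma p i j) (vel p i)
  = \sum_(i < n) \sum_(j < n | (i < j)%N)
      gamma * (m i * m j * (- (rho p i j / dist p i j ^+ 2)
       * dotv (pos p i - pos p j) (vel p i - vel p j))).
Proof.
under eq_bigr do rewrite dotv_suml.
rewrite (sum_offdiag (fun i j => dotv (pair_force m gamma p i j) (vel p i))).
apply: eq_bigr => i _; apply: eq_bigr => j _.
rewrite [pair_force m gamma p j i]pair_forceC /pair_force -scaleNr !dotvZl.
by rewrite !dotvE !mxE; ring.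
Qed.

(** * Derivatives along a solution *)

Lemma energyE (R : realType) (n : nat) (m : 'I_n -> R) (gamma : R)
    (p : state R n) :
  energy m gamma p =
  (\sum_(i < n) m i / 2 * dotv (vel p i) (vel p i))
  - gamma * (\sum_(i < n) \sum_(j < n | (i < j)%N) m i * m j * rho p i j).
Proof.
by rewrite /energy; congr (_ - _); apply: eq_bigr => i _; rewrite dotvE !expr2.
Qed.

Lemma distance_defectE (R : realType) (n : nat) (i j : 'I_n) (p : state R n) :
  distance_defect i j p =
  dist p i j ^+ 2 - dotv (pos p i - pos p j) (pos p i - pos p j).
Proof. by rewrite /distance_defect dotvE !mxE; ring. Qed.

Section IntegralsOfMotion.

Context (R : realType) (n : nat) (m : 'I_n -> R) (gamma : R).
Context (J : set R) (s : R -> state R n) (t : R).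
Hypotheses (sol : solution m gamma J s) (Jt : J t).

Let force i := \sum_(j < n | j != i) pair_force m gamma (s t) i j.

Lemma is_derive_vel i :
  is_derive t 1 (fun x => vel (s x) i) ('D_1 (fun x => vel (s x) i) t).
Proof. by apply: derivableP; apply: (sol_vel_derivable sol). Qed.

Lemma is_derive_linear_momentum i :
  is_derive t 1 (fun x => m i *: vel (s x) i) (force i).
Proof.
rewrite /force -(sol_vel sol Jt i).
by have := is_deriveZ (m i) (is_derive_vel i).
Qed.

Lemma is_derive_momentum : is_derive t 1 (fun x => momentum m (s x)) 0.
Proof.
rewrite -(sum_pair_force m gamma (s t)).
by apply: is_derive_sum_cond => i _; exact: is_derive_linear_momentum.
Qed.

(** Of the two terms of the product rule, [vel i] crossed with itself vanishes
    and the other one is the torque on body [i]. *)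
Lemma is_derive_angular_momentum :
  is_derive t 1 (fun x => angular_momentum m (s x)) 0.
Proof.
rewrite -(sum_pair_torque m gamma (s t)).
apply: is_derive_sum_cond => i _.
under eq_fun do rewrite -crossvZl.
apply: (is_derive_eq
  (is_derive_crossv (is_derive_linear_momentum i) (sol_pos sol Jt i))).
by rewrite crossvZl crossvv scaler0 add0r.
Qed.

(** The derivative of the first sum is the momentum, and so is that of the
    subtracted term, because the momentum has zero derivative. *)
Lemma is_derive_center_of_mass :
  is_derive t 1 (fun x => center_of_mass m x (s x)) 0.
Proof.
have posD : is_derive t 1 (fun x => \sum_(i < n) m i *: pos (s x) i)
    (momentum m (s t)).
  apply: is_derive_sum_cond => i _.
  by have := is_deriveZ (m i) (sol_pos sol Jt i).
apply: (is_derive_eq (is_deriveB posD (is_derive_id_scale is_derive_momentum))).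
by rewrite scaler0 addr0 subrr.
Qed.

(** The kinetic term and the potential term have the same derivative, the total
    power of the forces. *)
Lemma is_derive_energy : is_derive t 1 (fun x => energy m gamma (s x)) 0.
Proof.
under eq_fun do rewrite energyE.
have kinD : is_derive t 1
    (fun x => \sum_(i < n) m i / 2 * dotv (vel (s x) i) (vel (s x) i))
    (\sum_(i < n) dotv (force i) (vel (s t) i)).
  apply: is_derive_sum_cond => i _.
  have velD := is_derive_vel i.
  apply: (is_derive_eq (is_deriveZ (m i / 2) (is_derive_dotv velD velD))).
  rewrite /force -(sol_vel sol Jt i) dotvZl [dotv (vel _ _) _]dotvC.
  by rewrite /GRing.scale /=; field.
have potD : is_derive t 1
    (fun x => gamma *
       (\sum_(i < n) \sum_(j < n | (i < j)%N) m i * m j * rho (s x) i j))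
    (\sum_(i < n) dotv (force i) (vel (s t) i)).
  rewrite sum_pair_power; under eq_bigr do rewrite -mulr_sumr.
  rewrite -mulr_sumr; apply: is_deriveZ; apply: is_derive_sum_cond => i _.
  apply: is_derive_sum_cond => j ij; apply: is_deriveZ.
  by apply: (sol_rho sol Jt); rewrite -val_eqE /= ltn_eqF.
by apply: (is_derive_eq (is_deriveB kinD potD)); rewrite subrr.
Qed.

Lemma is_derive_distance_defect i j : i != j ->
  is_derive t 1 (fun x => distance_defect i j (s x)) 0.
Proof.
move=> ij; under eq_fun do rewrite distance_defectE.
have relD := is_deriveB (sol_pos sol Jt i) (sol_pos sol Jt j).
apply: (is_derive_eq (is_deriveB (is_deriveX 2 (sol_dist sol Jt ij))
                                 (is_derive_dotv relD relD))).
rewrite [dotv (vel _ _ - _) _]dotvC /GRing.scale /=.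
by field; exact: dist_neq0.
Qed.

Lemma is_derive_dist_rho i j : i != j ->
  is_derive t 1 (fun x => dist (s x) i j * rho (s x) i j) 0.
Proof.
move=> ij.
apply: (is_derive_eq (is_deriveM (sol_dist sol Jt ij) (sol_rho sol Jt ij))).
by rewrite /GRing.scale /=; field; exact: dist_neq0.
Qed.

End IntegralsOfMotion.

(** * The integrals of motion *)

Theorem theorem2 (R : realType) (n : nat) (m : 'I_n -> R) (gamma : R)
    (hn : (2 <= n)%N) (hm : forall i, 0 < m i) (hgamma : 0 < gamma) :
  [/\ integral_of_motion m gamma (fun _ p => momentum m p),
      integral_of_motion m gamma (fun _ p => angular_momentum m p),
      integral_of_motion m gamma (fun t p => center_of_mass m t p),
      integral_of_motion m gamma (fun _ p => energy m gamma p)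
    & (forall i j : 'I_n, i != j ->
         integral_of_motion m gamma (fun _ p => distance_defect i j p)) /\
      (forall i j : 'I_n, i != j ->
         integral_of_motion m gamma (fun _ p => dist p i j * rho p i j))].
Proof.
split=> [J s _ Jitv sol t1 t2|J s _ Jitv sol t1 t2|J s _ Jitv sol t1 t2|
         J s _ Jitv sol t1 t2|].
- apply: (mx_constant_on_interval
    (f := fun x => momentum m (s x)) Jitv).
  by move=> t; exact: is_derive_momentum sol.
- apply: (mx_constant_on_interval
    (f := fun x => angular_momentum m (s x)) Jitv).
  by move=> t; exact: is_derive_angular_momentum sol.
- apply: (mx_constant_on_interval
    (f := fun x => center_of_mass m x (s x)) Jitv).
  by move=> t; exact: is_derive_center_of_mass sol.
- apply: (constant_on_interval (f := fun x => energy m gamma (s x)) Jitv).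
  by move=> t; exact: is_derive_energy sol.
- split=> i j ij J s _ Jitv sol t1 t2.
    apply: (constant_on_interval
      (f := fun x => distance_defect i j (s x)) Jitv).
    by move=> t Jt; exact: is_derive_distance_defect sol Jt _ _ ij.
  apply: (constant_on_interval
    (f := fun x => dist (s x) i j * rho (s x) i j) Jitv).
  by move=> t Jt; exact: is_derive_dist_rho sol Jt _ _ ij.
Qed.
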